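(* Let $M_\preceq=(S,\Sigma,T,\mathbf{E},\mathbf{D})$ be a monotonic MDP with $T=\{\tau_1,\dots,\tau_m\}$, let $\lambda$ be a memoryless strategy, and let $B,C\subseteq S$. Then the output of $\textsc{Split}(B,C,\lambda)$ is a partition $\{B_1,\dots,B_k\}$ of $B$ such that for all $s,s'\in B$, $s$ and $s'$ lie in the same $B_l$ if and only if $\mathbf{P}_\lambda(s,C)=\mathbf{P}_\lambda(s',C)$.
   Context: An MDP is a tuple $(S,\Sigma,T,\mathbf{E},\mathbf{D})$ where $S$ is a finite set of states, $\Sigma$ and $T$ are disjoint finite sets of actions, $\mathbf{E}$ is a partial function assigning to some pairs $(s,\sigma)$ a total function $\mathbf{E}(s,\sigma):T\to S$, and $\mathbf{D}$ a partial function with the same domain assigning a probability distribution on $T$; $\Sigma_s=\{\sigma\mid(s,\sigma)\text{ in the domain}\}\neq\emptyset$ for all $s$. It is monotonic if (1) $S$ carries a partial order $\preceq$ such that any two elements have a greatest lower bound, and (2) for all $s\preceq s'$, $\sigma,\tau$, $t'$ with $\mathbf{E}(s',\sigma)(\tau)=t'$, there is $t$ with $\mathbf{E}(s,\sigma)(\tau)=t\preceq t'$. A memoryless strategy is a map $\lambda:S\to\Sigma$ with $\lambda(s)\in\Sigma_s$. Write $\mathbf{E}_\lambda(s)=\mathbf{E}(s,\lambda(s))$, $\mathbf{D}_\lambda(s)=\mathbf{D}(s,\lambda(s))$, and $\mathbf{P}_\lambda(s,C)=\sum_{\tau\in T,\ \mathbf{E}_\lambda(s)(\tau)\in C}\mathbf{D}_\lambda(s)(\tau)$.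 Let $\mathsf{Pre}_\lambda(C,\tau)=\{s\in S\mid \mathbf{E}_\lambda(s)(\tau)\in C\}$. Let $\mathcal{P}_{\mathbf{D},\lambda}$ be the partition of $S$ into classes of the relation $s\sim s'$ iff $\mathbf{D}_\lambda(s)=\mathbf{D}_\lambda(s')$, and for a class $D$ write $\mathbf{D}_\lambda(D)$ for the common distribution. Algorithm $\textsc{Split}(B,C,\lambda)$ maintains a table $P$, a finite map from real numbers to subsets of $S$. Initially $P$ maps $0$ to $B$. For $i=1,\dots,m$: start a new table $P_{\mathrm{new}}$ mapping every key to $\emptyset$; for each entry $(p,\mathit{block})$ of $P$, add $\mathit{block}\setminus\mathsf{Pre}_\lambda(C,\tau_i)$ (by union) to $P_{\mathrm{new}}[p]$, and for each $D\in\mathcal{P}_{\mathbf{D},\lambda}$ add $\mathit{block}\cap D\cap\mathsf{Pre}_\lambda(C,\tau_i)$ (by union) to $P_{\mathrm{new}}[p+\mathbf{D}_\lambda(D)(\tau_i)]$; then set $P$ to $P_{\mathrm{new}}$ with all entries having empty set removed. The output is the set of sets stored in the final table $P$. *)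

(* Defs.v *)
From HB Require Import structures.
From mathcomp Require Import all_boot all_order all_algebra.
From mathcomp Require Import finmap reals.

Set Implicit Arguments.
Unset Strict Implicit.
Unset Printing Implicit Defensive.

Import Order.TTheory GRing.Theory Num.Theory.

Local Open Scope ring_scope.

Record distr (R : realType) (T : finType) := Distr {
  mass :> {ffun T -> R};
  distrP : [forall t, 0 <= mass t] && (\sum_t mass t == 1)
}.

HB.instance Definition _ (R : realType) (T : finType) :=
  [isSub for @mass R T].
HB.instance Definition _ (R : realType) (T : finType) :=
  [Equality of distr R T by <:].

Definition oget (A : Type) (o : option A) : isSome o -> A :=
  match o return isSome o -> A with
  | Some x => fun=> x
  | None => fun h => False_rect A (notF h)
  end.

(* Partial functions are option-valued. The action sets Sigma and T, being     *)
(* distinct types, are disjoint.                                               *)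
Record mdp (R : realType) (S Sigma T : finType) := MDP {
  mdpE : S -> Sigma -> option {ffun T -> S};
  mdpD : S -> Sigma -> option (distr R T);
  mdp_dom : forall s a, isSome (mdpD s a) = isSome (mdpE s a);
  mdp_enabled : forall s, exists a, isSome (mdpE s a)
}.

Definition step (R : realType) (S Sigma T : finType) (M : mdp R S Sigma T)
    (s : S) (a : Sigma) (t : T) : option S :=
  omap (fun f : {ffun T -> S} => f t) (mdpE M s a).

Definition has_glb (disp : Order.disp_t) (S : porderType disp) (x y : S) :=
  exists g : S, [/\ (g <= x)%O, (g <= y)%O &
    forall z : S, (z <= x)%O -> (z <= y)%O -> (z <= g)%O].

Definition monotonic (R : realType) (disp : Order.disp_t)
    (S : finPOrderType disp) (Sigma T : finType) (M : mdp R S Sigma T) : Prop :=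
  (forall x y : S, has_glb x y) /\
  (forall s s' : S, (s <= s')%O -> forall (a : Sigma) (tau : T) (t' : S),
     step M s' a tau = Some t' ->
     exists2 t : S, step M s a tau = Some t & (t <= t')%O).

Record strategy (R : realType) (S Sigma T : finType) (M : mdp R S Sigma T) :=
  Strategy {
    strat :> S -> Sigma;
    stratP : forall s, isSome (mdpE M s (strat s))
  }.

Section Split.
Variables (R : realType) (S Sigma T : finType) (M : mdp R S Sigma T).
Variable lam : strategy M.

Lemma stratDP s : isSome (mdpD M s (lam s)).
Proof. by rewrite mdp_dom stratP. Qed.

Definition E_ (s : S) : {ffun T -> S} := oget (stratP lam s).

Definition D_ (s : S) : distr R T := oget (stratDP s).

Definition P_ (s : S) (C : {set S}) : R := \sum_(t | E_ s t \in C) D_ s t.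

Definition Pre (C : {set S}) (t : T) : {set S} := [set s | E_ s t \in C].

Definition partD : {set {set S}} := preim_partition D_ [set: S].

(* The distribution common to a class X is read off at an arbitrary element;   *)
(* the default 0 is unreachable, since no X in partD is empty.                 *)
Definition class_mass (X : {set S}) (t : T) : R :=
  if [pick s in X] is Some s then D_ s t else 0.

Definition table := {fmap R -> {set S}}.

(* An absent key counts as mapped to the empty set. *)
Definition tget (P : table) (p : R) : {set S} := odflt set0 P.[? p]%fmap.

Definition tadd (P : table) (p : R) (X : {set S}) : table :=
  P.[p <- tget P p :|: X]%fmap.

Definition tclean (P : table) : table :=
  P.[& [fset p in domf P | tget P p != set0]%fset]%fmap.

Definition split_entry (C : {set S}) (t : T) (p : R) (block : {set S})
    (Pnew : table) : table :=
  foldl (fun Q X => tadd Q (p + class_mass X t) (block :&: X :&: Pre C t))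
        (tadd Pnew p (block :\: Pre C t))
        (enum partD).

Definition split_round (C : {set S}) (P : table) (t : T) : table :=
  tclean (foldl (fun Q p => split_entry C t p (tget P p) Q)
                [fmap]%fmap (enum_fset (domf P))).

Definition split_table (B C : {set S}) (tau : seq T) : table :=
  foldl (split_round C) [fmap].[0 <- B]%fmap tau.

Definition Split_alg (B C : {set S}) (tau : seq T) : {set {set S}} :=
  [set X : {set S} | X \in codomf (split_table B C tau)].

End Split.

(* Main.v *)
Require Import Defs.
From mathcomp Require Import all_boot all_order all_algebra.
From mathcomp Require Import finmap reals.

(** After processing the actions [ts], the table sends each key [p] to the set
    of states [s] of [B] whose partial probability
    [\sum_(t <- ts | E_ s t \in C) D_ s t] equals [p]. Once all actions have been
    processed this partial probability is [P_ s C], so the stored sets are the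
    fibres of [P_ _ C] on [B]; none of them is empty because every round ends
    with a cleaning step. *)

Section SplitCorrectness.
Set Implicit Arguments.
Unset Strict Implicit.
Import GRing.Theory.
Local Open Scope ring_scope.
Variables (R : realType) (S Sigma T : finType) (M : mdp R S Sigma T).
Variable lam : strategy M.
Implicit Types (P Q : table R S) (B C X : {set S}) (s : S) (t : T) (p q : R).

Definition hit_mass C s t : R := if E_ lam s t \in C then D_ lam s t else 0.

(** Since [tget] reads an absent key as [set0], this invariant does not distinguish an absent key
    from one storing the empty set. It therefore survives [tclean], and nonemptiness is tracked
    separately. *)
Definition represents P B (f : S -> R) :=
  forall s q, (s \in tget P q) = (s \in B) && (q == f s).

Lemma in_tget_tadd P p X s q :
  (s \in tget (tadd P p X) q) = (s \in tget P q) || (q == p) && (s \in X).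
Proof.
rewrite {1}/tget /tadd fnd_set; case: eqP => [->|_] /=; last by rewrite orbF.
by rewrite inE.
Qed.

(** Each [tadd] takes a union with what the key already holds, so insertions at colliding keys
    accumulate and nothing is overwritten. *)
Lemma in_tget_foldl_tadd (A : eqType) (k : A -> R) (F : A -> {set S})
    (xs : seq A) Q s q :
  (s \in tget (foldl (fun Q' x => tadd Q' (k x) (F x)) Q xs) q) =
  (s \in tget Q q) || has (fun x => (q == k x) && (s \in F x)) xs.
Proof.
elim: xs Q => [|x xs IH] Q /=; first by rewrite orbF.
by rewrite IH in_tget_tadd orbA.
Qed.

Lemma partD_partition : partition (partD lam) [set: S].
Proof. exact: preim_partitionP. Qed.

(** The element picked from [X] is arbitrary, but members of one block of [partD] share their
    distribution. *)
Lemma class_mass_in X s t :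
  X \in partD lam -> s \in X -> class_mass lam X t = D_ lam s t.
Proof.
move=> XP sX; rewrite /class_mass; case: pickP => [u uX|/(_ s)]; last first.
  by rewrite sX.
have [_ tI _] := and3P partD_partition.
have Xs : pblock (partD lam) s = X by exact: def_pblock.
have : u \in pblock (partD lam) s by rewrite Xs.
rewrite pblock_equivalence_partition ?inE //; first by move/eqP=> ->.
by split=> //; move=> /eqP->.
Qed.

(** A state of [X] outside [Pre] stays at [p]; one inside is moved only by the class of [partD]
    containing it, hence by its own mass at [t]. *)
Lemma in_tget_split_entry C t p X Q s q :
  (s \in tget (split_entry lam C t p X Q) q) =
  (s \in tget Q q) || (s \in X) && (q == p + hit_mass C s t).
Proof.
rewrite /split_entry in_tget_foldl_tadd in_tget_tadd -orbA; congr (_ || _).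
rewrite !inE /hit_mass; case: ifP => EC /=; last first.
  rewrite addr0 andbC [X in _ || X](_ : _ = false) ?orbF //.
  by apply/hasP => -[Y _]; rewrite !inE EC !andbF.
rewrite andbF /=; apply/hasP/andP => [[Y]|[sX /eqP qE]].
  rewrite mem_enum => YP /andP[/eqP-> ]; rewrite !inE EC andbT => /andP[sX sY].
  by rewrite (class_mass_in _ YP sY).
have cov : s \in cover (partD lam).
  by rewrite (cover_partition partD_partition) inE.
exists (pblock (partD lam) s); first by rewrite mem_enum pblock_mem.
rewrite (class_mass_in (s := s)) ?pblock_mem ?mem_pblock // qE eqxx.
by rewrite !inE EC sX mem_pblock cov.
Qed.

Lemma in_tget_foldl_split_entry C t P (ps : seq R) Q s q :
  (s \in tget (foldl (fun Q' p => split_entry lam C t p (tget P p) Q') Q ps) q)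
  = (s \in tget Q q) ||
    has (fun p => (s \in tget P p) && (q == p + hit_mass C s t)) ps.
Proof.
elim: ps Q => [|p ps IH] Q /=; first by rewrite orbF.
by rewrite IH in_tget_split_entry orbA.
Qed.

Lemma tget_tclean P q : tget (tclean P) q = tget P q.
Proof.
rewrite {1}/tget /tclean fnd_restrict !inE /=.
case: ifPn => //; rewrite negb_and negbK => /orP[qP|/eqP-> //].
by rewrite /tget not_fnd.
Qed.

Lemma tclean_neq0 P q : q \in domf (tclean P) -> tget (tclean P) q != set0.
Proof. by rewrite tget_tclean !inE /= => /and3P[]. Qed.

Lemma in_tget_domf P s q : s \in tget P q -> q \in domf P.
Proof. by rewrite /tget; case: fndP => //=; rewrite inE. Qed.

Lemma split_round_represents C P t B f :
  represents P B f ->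
  represents (split_round lam C P t) B (fun s => f s + hit_mass C s t).
Proof.
move=> Pf s q; rewrite tget_tclean in_tget_foldl_split_entry.
rewrite {1}/tget fnd_fmap0 inE /=.
apply/hasP/andP => [[p _]|[sB /eqP->]].
  by rewrite Pf => /andP[/andP[-> /eqP->]].
(* The only key holding [s] is [f s]; it lies in the domain, because an absent key would read as
   [set0], so the fold visits it. *)
have sP : s \in tget P (f s) by rewrite Pf sB eqxx.
by exists (f s); [exact: in_tget_domf sP | rewrite sP eqxx].
Qed.

Lemma foldl_split_round_represents C (ts : seq T) P B f :
  represents P B f ->
  represents (foldl (split_round lam C) P ts) B
    (fun s => f s + \sum_(t <- ts) hit_mass C s t).
Proof.
elim: ts P f => [|t ts IH] P f Pf /=.
  by move=> s q; rewrite big_nil addr0.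
move=> s q; rewrite (IH _ _ (split_round_represents C t Pf)).
by rewrite big_cons addrA.
Qed.

Lemma split_table_represents B C (ts : seq T) :
  represents (split_table lam B C ts) B
    (fun s => \sum_(t <- ts) hit_mass C s t).
Proof.
have P0 : represents [fmap].[0 <- B]%fmap B (fun=> 0).
  move=> s q; rewrite /tget fnd_set fnd_fmap0.
  by case: eqP => _ /=; rewrite ?andbT ?andbF ?inE.
by move=> s q; rewrite (foldl_split_round_represents C ts P0) add0r.
Qed.

(** The initial table stores [B] even when [B] is empty, so at least one round is required; the
    cleaning that ends the last round then discards empty blocks. *)
Lemma split_table_neq0 B C (ts : seq T) q :
  (0 < size ts)%N -> q \in domf (split_table lam B C ts) ->
  tget (split_table lam B C ts) q != set0.
Proof.
case/lastP: ts => // ts t _; rewrite /split_table foldl_rcons.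
exact: tclean_neq0.
Qed.

Lemma sum_hit_mass C s (ts : seq T) :
  uniq ts -> (forall t, t \in ts) ->
  \sum_(t <- ts) hit_mass C s t = P_ lam s C.
Proof.
move=> uts tsT; rewrite /P_ [RHS]big_mkcond /= big_uniq //=.
by apply: eq_bigl => t; rewrite tsT.
Qed.

Lemma split_table_fibre B C (ts : seq T) q :
  uniq ts -> (forall t, t \in ts) ->
  tget (split_table lam B C ts) q = [set s in B | P_ lam s C == q].
Proof.
move=> uts tsT; apply/setP => s.
by rewrite split_table_represents sum_hit_mass // inE eq_sym.
Qed.

Lemma mem_Split_alg B C (ts : seq T) X :
  (0 < size ts)%N -> uniq ts -> (forall t, t \in ts) ->
  X \in Split_alg lam B C ts <->
  exists2 s, s \in B & X = [set s' in B | P_ lam s' C == P_ lam s C].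
Proof.
move=> ts0 uts tsT; rewrite inE; split=> [/codomfP[q qX]|[s sB ->]].
  have XE : tget (split_table lam B C ts) q = X by rewrite /tget qX.
  have /set0Pn[s] : X != set0.
    by rewrite -XE split_table_neq0 //; case: fndP qX.
  rewrite -XE split_table_fibre // inE => /andP[sB /eqP<-].
  by exists s.
have := split_table_fibre B C (P_ lam s C) uts tsT.
(* An absent key would make the fibre through [s] empty, although it contains [s]. *)
rewrite /tget; case E: (_.[? _])%fmap => [Y|] /= YE; last first.
  by have /setP/(_ s) := YE; rewrite !inE sB eqxx.
by apply/codomfP; exists (P_ lam s C); rewrite E YE.
Qed.

(** The fibres of [P_ _ C] on [B] are the classes of its kernel, so being a partition follows from
    the general fact on [preim_partition]. *)
Lemma Split_algE B C (ts : seq T) :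
  (0 < size ts)%N -> uniq ts -> (forall t, t \in ts) ->
  Split_alg lam B C ts = preim_partition (fun s => P_ lam s C) B.
Proof.
move=> ts0 uts tsT; apply/setP => X; apply/idP/imsetP.
  move=> /(mem_Split_alg B C X ts0 uts tsT)[s sB ->]; exists s => //.
  by apply/setP => s'; rewrite !inE eq_sym.
move=> [s sB ->]; apply/(mem_Split_alg B C _ ts0 uts tsT); exists s => //.
by apply/setP => s'; rewrite !inE eq_sym.
Qed.

End SplitCorrectness.

Theorem theorem1 (R : realType) (disp : Order.disp_t) (S : finPOrderType disp)
    (Sigma T : finType) (M : mdp R S Sigma T) (hM : monotonic M)
    (m : nat) (hm : 0 < m) (tau : m.-tuple T) (tau_uniq : uniq tau)
    (tau_full : forall t : T, t \in tau)
    (lam : strategy M) (B C : {set S}) :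
  partition (Split_alg lam B C tau) B /\
  forall s s' : S, s \in B -> s' \in B ->
    ((exists Bl : {set S},
        [/\ Bl \in Split_alg lam B C tau, s \in Bl & s' \in Bl])
     <-> P_ lam s C = P_ lam s' C).
Proof.
have tau0 : 0 < size tau by rewrite size_tuple.
split; first by rewrite Split_algE //; exact: preim_partitionP.
move=> s s' sB s'B; split=> [[X []]|ss'].
  move=> /(mem_Split_alg _ _ _ _ tau0 tau_uniq tau_full)[u _ ->].
  by rewrite !inE => /andP[_ /eqP->] /andP[_ /eqP->].
exists [set u in B | P_ lam u C == P_ lam s C].
split; try by rewrite inE ?sB ?s'B ?ss' eqxx.
by apply/mem_Split_alg => //; exists s.
Qed.
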